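(* Let $\epsilon\le 1/10$ and let $\delta<1$ be any positive constant. Suppose each of the $n$ nodes starts with an input value chosen by a late $\epsilon$-bounded adaptive blocking adversary from a domain of size polynomial in $n$. Then there is a distributed algorithm that, against this adversary, terminates in $O(\log n)$ rounds and sends $O(n\log n)$ messages in total, and with high probability at least $(1-\epsilon/\delta)n$ nodes decide on the same value, and if all nodes start with the same input value $x$ then $x$ is the only possible decision.
   Context: Model: $n$ anonymous nodes, every pair of which can communicate directly, operate in synchronous rounds; in each round every node first receives all messages sent to it in the previous round that were not blocked, then performs arbitrary local computation, then sends messages. A late $\epsilon$-bounded adaptive adversary (with unlimited computational power): at the start of each round $t\ge 2$ it observes the complete state of the system at the beginning of round $t-1$, and based on this chooses a set of at most $\epsilon n$ nodes to block in round $t$; a blocked node can neither send nor receive messages in that round. In round 1 the adversary knows the initial state but not the random choices of the nodes in that round. ''With high probability'' means with probability at least $1-n^{-\Omega(1)}$. *)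

(* Defs.v *)
From Stdlib Require Import Reals.
From mathcomp Require Import all_boot.

(* A (randomized, anonymous) distributed algorithm for n nodes whose inputs  *)
(* come from the domain 'I_m.  All nodes run the same code and have no       *)
(* identifier.  A node reaches the other n-1 nodes through its ports         *)
(* 'I_n.-1 (the port numbering is chosen adversarially, see [valid_ports]).  *)
(* In every round a node draws a fresh uniformly random coin from the finite *)
(* type Coin, and from its state, the messages received (indexed by the      *)
(* port they arrived on) and the coin computes a new state and the messages  *)
(* to send on each port.  After [rounds] rounds every node outputs           *)
(* [output st] : None = no decision, Some y = decides y.                     *)
Record algo (n m : nat) := Algo {
  St : Type;
  Msg : Type;
  Coin : finType;
  coin0 : Coin;
  rounds : nat;
  init : 'I_m -> St;
  step : St -> ('I_n.-1 -> seq Msg) -> Coin -> St * ('I_n.-1 -> seq Msg);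
  output : St -> option 'I_m
}.
Arguments St {n m}.
Arguments Msg {n m}.
Arguments Coin {n m}.
Arguments coin0 {n m}.
Arguments rounds {n m}.
Arguments init {n m}.
Arguments step {n m}.
Arguments output {n m}.

Section Exec.
Variables (n m : nat) (A : algo n m).

(* Complete state of the system at the beginning of a round: the local      *)
(* states, and the messages sent in the previous round (by sender and       *)
(* sender port; messages of a sender blocked in that round are absent).     *)
Record config := Config {
  cst : 'I_n -> St A;
  cout : 'I_n -> 'I_n.-1 -> seq (Msg A)
}.

(* port u p = the node reached by node u through its port p. *)
Definition ports := 'I_n -> 'I_n.-1 -> 'I_n.

Definition valid_ports (port : ports) : Prop :=
  forall u, injective (port u) /\ forall p, port u p != u.

(* A late adaptive adversary: the set of nodes it blocks in round r          *)
(* (rounds numbered from 0) is a function of the history of complete         *)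
(* configurations it has observed (see [configs] below: at round r >= 1 it   *)
(* has seen the configurations at the beginning of rounds 0..r-1, and at     *)
(* round 0 it has seen the initial configuration).  Its computational power  *)
(* is unlimited (arbitrary functions).                                       *)
Definition adversary := nat -> seq config -> {set 'I_n}.

Definition eps_bounded (eps : R) (adv : adversary) : Prop :=
  forall r h, Rle (INR #|adv r h|) (Rmult eps (INR n)).

Definition coin_space := {ffun 'I_(rounds A) -> {ffun 'I_n -> Coin A}}.

Variables (port : ports) (inp : 'I_n -> 'I_m) (adv : adversary).

Definition init_config : config :=
  Config (fun v => init A (inp v)) (fun _ _ => [::]).

Definition inbox (c : config) (B : {set 'I_n}) (v : 'I_n)
  : 'I_n.-1 -> seq (Msg A) :=
  fun q => if v \in B then [::] else
    let u := port v q in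
    match [pick p | port u p == v] with
    | Some p => cout c u p
    | None => [::]
    end.

Definition round (c : config) (B : {set 'I_n}) (w : 'I_n -> Coin A) : config :=
  Config (fun v => (step A (cst c v) (inbox c B v) (w v)).1)
         (fun v p => if v \in B then [::]
                     else (step A (cst c v) (inbox c B v) (w v)).2 p).

Definition coin_at (w : coin_space) (r : nat) (v : 'I_n) : Coin A :=
  match (insub r : option 'I_(rounds A)) with
  | Some i => w i v
  | None => coin0 A
  end.

(* configs w r = [c_0; ...; c_r], c_k the configuration at the beginning of  *)
(* round k (0-indexed).  The blocked set of round r is chosen by the         *)
(* adversary from [c_0; ...; c_(max 0 (r-1))]. *)
Fixpoint configs (w : coin_space) (r : nat) : seq config :=
  match r with
  | 0 => [:: init_config]
  | r'.+1 =>
      let h := configs w r' in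
      rcons h (round (last init_config h) (adv r' (take (maxn 1 r') h))
                     (coin_at w r'))
  end.

Definition final (w : coin_space) : config :=
  last init_config (configs w (rounds A)).

Definition decision (w : coin_space) (v : 'I_n) : option 'I_m :=
  output A (cst (final w) v).

(* number of messages sent (by non-blocked senders) in the previous round *)
Definition msgs_in (c : config) : nat :=
  \sum_(v < n) \sum_(p < n.-1) size (cout c v p).

Definition total_msgs (w : coin_space) : nat :=
  \sum_(c <- configs w (rounds A)) msgs_in c.

Definition max_agree (w : coin_space) : nat :=
  \max_(y < m) #|[set v | decision w v == Some y]|.

End Exec.
Arguments valid_ports {n}.
Arguments cst {n m A}.
Arguments cout {n m A}.
Arguments adversary {n m} A.
Arguments eps_bounded {n m A}.
Arguments coin_space {n m} A.
Arguments init_config {n m A}.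
Arguments inbox {n m A}.
Arguments round {n m A}.
Arguments coin_at {n m A}.
Arguments configs {n m A}.
Arguments final {n m A}.
Arguments decision {n m A}.
Arguments msgs_in {n m A}.
Arguments total_msgs {n m A}.
Arguments max_agree {n m A}.

Definition prob (T : finType) (P : pred T) : R :=
  Rdiv (INR #|[set w | P w]|) (INR #|{: T}|).

Definition Rleb (x y : R) : bool := if Rle_dec x y then true else false.

(* Main.v *)
Require Import Defs.
From Stdlib Require Import Reals.
From mathcomp Require Import all_boot.
From mathcomp Require Import zify.
From Stdlib Require Import Lra.

(* Every node pushes its input to O(log n) random ports; then, for log n rounds,
   every node pushes the least value it has just received to five random ports,
   and a last burst of O(log n) messages per node ends the algorithm.  The
   blocked set of the first round is fixed by the initial state, so the least
   input among the other nodes is a fixed value that is never undercut later.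
   The nodes that receive it in a round are not blocked in that round, hence
   they forward it, and the set blocked when their messages arrive does not
   depend on the ports they draw.  So the number of its fresh receivers doubles
   until it is a constant fraction of n, and the last burst reaches every node
   that is not blocked at the end.  Each step fails for at most a fraction 1/n
   of the coins; these fractions are computed by redrawing one coin at a time. *)

Set Implicit Arguments.
Unset Strict Implicit.
Unset Printing Implicit Defensive.

Delimit Scope R_scope with real.

(** * Counting by redrawing one coordinate *)

Section Resample.
Variables (W D : finType) (get : W -> D) (upd : W -> D -> W).
Hypothesis get_upd : forall w d, get (upd w d) = d.
Hypothesis upd_get : forall w, upd w (get w) = w.
Hypothesis upd_upd : forall w d d', upd (upd w d) d' = upd w d'.

(** Exchanging the stored coordinate with the fresh one is an involution of [W * D], so a redraw
    leaves the average of [f] unchanged. *)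
Lemma sum_resample (f : W -> nat) :
  \sum_w \sum_d f (upd w d) = #|D| * \sum_w f w.
Proof.
pose h (p : W * D) := (upd p.1 p.2, get p.1).
have hK : involutive h by case=> w d; rewrite /h /= upd_upd upd_get get_upd.
rewrite pair_bigA /= (eq_bigr (fun p => f (h p).1)) //.
rewrite -(reindex_inj (inv_inj hK) (P := predT) (F := fun p : W * D => f p.1)).
rewrite -(pair_bigA _ (fun w _ => f w)) big_distrr /=.
by apply: eq_bigr => w _; rewrite sum_nat_const.
Qed.

End Resample.

(** Last step of a Markov bound: [s ^ h] is the initial potential, [r / q] the decay, and
    [r * s / q <= 1/2] leaves a failure ratio of [2 ^ -h]. *)
Lemma ratio_exp_leq q r s h c N : 0 < r * s -> 2 * (r * s) <= q ->
  q ^ h * c <= r ^ h * (N * s ^ h) -> 2 ^ h * c <= N.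
Proof.
move=> rs0 le; rewrite [N * _]mulnC mulnA -expnMn => H.
have p0 : 0 < (r * s) ^ h by rewrite expn_gt0 rs0.
rewrite -(leq_pmul2l p0); apply: leq_trans H.
rewrite mulnA -expnMn [r * s * 2]mulnC leq_mul2r; apply/orP; right.
by case: h {p0} => // h; rewrite leq_exp2r.
Qed.

Lemma card_set_sum (T : finType) (P : pred T) : #|[set x | P x]| = \sum_x P x.
Proof.
by rewrite -sum1_card big_mkcond /=; apply: eq_bigr => x _; rewrite inE; case: P.
Qed.

Lemma card_exists_leq (I T : finType) (P : I -> pred T) :
  #|[set x | [exists i, P i x]]| <= \sum_i #|[set x | P i x]|.
Proof.
under eq_bigr do rewrite card_set_sum.
rewrite card_set_sum exchange_big; apply: leq_sum => x _.
by case: existsP => // -[i Pix]; rewrite (bigD1 i) //= Pix.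
Qed.

(** * Receivers of independent random pushes *)

Section Targets.
Variables (n' K : nat).
Local Notation n := n'.+2.
Variable port : ports n.
Hypothesis vport : valid_ports port.

Local Notation D := 'I_n'.+1.
Local Notation draw := {ffun 'I_n -> {ffun 'I_K -> 'I_n'.+1}}.
Local Notation pos := ('I_n * 'I_K)%type.

Definition redraw (a : pos) (x : draw) (p : D) : draw :=
  [ffun u => [ffun j => if (u, j) == a then p else x u j]].

Definition target (x : draw) (a : pos) : 'I_n := port a.1 (x a.1 a.2).

Lemma sum_redraw (a : pos) (f : draw -> nat) :
  \sum_(x : draw) \sum_p f (redraw a x p) = n'.+1 * \sum_(x : draw) f x.
Proof.
rewrite (sum_resample (get := fun x : draw => x a.1 a.2)) ?card_ord //.
- by move=> x p; rewrite !ffunE -surjective_pairing eqxx.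
- move=> x; apply/ffunP => u; apply/ffunP => j; rewrite !ffunE.
  by case: eqP => // <-.
- move=> x p p'; apply/ffunP => u; apply/ffunP => j; rewrite !ffunE.
  by case: eqP.
Qed.

Lemma target_redraw_same a x p : target (redraw a x p) a = port a.1 p.
Proof. by rewrite /target !ffunE -surjective_pairing eqxx. Qed.

Lemma target_redraw_other a b x p :
  b != a -> target (redraw a x p) b = target x b.
Proof.
by move=> ba; rewrite /target !ffunE -surjective_pairing (negbTE ba).
Qed.

(** The positions form a list so that messages can be exposed one at a time, by induction. *)
Definition reached (B : {set 'I_n}) (l : seq pos) (x : draw) : {set 'I_n} :=
  [set v | (v \notin B) && has (fun a => target x a == v) l].

Lemma reached_redraw B l a x p :
  a \notin l -> reached B l (redraw a x p) = reached B l x.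
Proof.
move=> al; apply/setP => v; rewrite !inE; congr (_ && _).
apply: eq_in_has => b bl; rewrite target_redraw_other //.
by apply: contraNneq al => <-.
Qed.

Lemma reached_cons B l a x p : a \notin l ->
  reached B (a :: l) (redraw a x p) =
  if port a.1 p \in B then reached B l x else port a.1 p |: reached B l x.
Proof.
move=> al; rewrite -(reached_redraw B x p al).
apply/setP => v; case: ifP => hB; rewrite !inE /= target_redraw_same.
  by case: eqP => [<-|]; rewrite ?hB.
rewrite [v == _]eq_sym; case: (_ =P v) => [<-|] //=; by rewrite hB.
Qed.

(** Exponential potential for Markov's inequality. Truncated subtraction would leave it at 1 once
    the goal is met; it must drop to 0 there to keep decaying by a constant factor. *)
Definition deficit (g k : nat) := if k < g then 4 ^ (g - k) else 0.

Lemma deficitS g k : 4 * deficit g k.+1 <= deficit g k.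
Proof.
rewrite /deficit; case: (ltnP k.+1 g) => [h|]; last by rewrite muln0.
by rewrite (ltnW h) -expnS subnSK // ltnW.
Qed.

Lemma leq_card_ports u (C : {set 'I_n}) : #|[set p | port u p \in C]| <= #|C|.
Proof.
rewrite -(card_imset _ (proj1 (vport u))); apply: subset_leq_card.
by apply/subsetP => v /imsetP[p]; rewrite inE => ? ->.
Qed.

(* One more message leaves the reached set unchanged with probability at most
   1/5, and otherwise divides the potential by 4: a factor 1/5 + 1/4 = 9/20. *)
Lemma deficit_step (B : {set 'I_n}) g (l : seq pos) a (x : draw) :
  a \notin l -> 5 * (#|B| + g) <= n'.+1 ->
  20 * \sum_p deficit g #|reached B (a :: l) (redraw a x p)| <=
  9 * n'.+1 * deficit g #|reached B l x|.
Proof.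
move=> al hB; set r := reached B l x.
case: (ltnP #|r| g) => hg; last first.
  rewrite big1 ?muln0 // => p _; rewrite reached_cons // -/r /deficit.
  case: (port a.1 p \in B); first by rewrite ltnNge hg.
  by rewrite ltnNge (leq_trans hg) // subset_leq_card // subsetUr.
pose C := B :|: r.
have step p : 4 * deficit g #|reached B (a :: l) (redraw a x p)| <=
    4 * ((port a.1 p \in C) * deficit g #|r|) + deficit g #|r|.
  rewrite reached_cons // -/r inE; case: ifP => hp /=.
    by rewrite mul1n leq_addr.
  case: (boolP (port a.1 p \in r)) => hr /=.
    by rewrite (setUidPr _) ?sub1set // mul1n leq_addr.
  rewrite cardsU1 hr add1n.
  by rewrite deficitS.
have hC : 5 * \sum_p (port a.1 p \in C : nat) <= n'.+1.
  rewrite -big_mkcond /= sum1_card; apply: leq_trans hB; rewrite leq_mul2l /=.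
  rewrite -cardsE; apply: leq_trans (leq_card_ports a.1 C) _.
  apply: leq_trans (leq_card_setU _ _) _; rewrite leq_add2l; exact: ltnW.
have : 4 * \sum_p deficit g #|reached B (a :: l) (redraw a x p)| <=
       4 * ((\sum_p (port a.1 p \in C : nat)) * deficit g #|r|)
       + n'.+1 * deficit g #|r|.
  rewrite big_distrr big_distrl big_distrr /=.
  rewrite -[n'.+1 in X in _ <= _ + X * _]card_ord -sum_nat_const -big_split /=.
  by apply: leq_sum => p _; apply: step.
nia.
Qed.

(** Each exposed message multiplies the average potential by at most 9/20. *)
Lemma deficit_sum (B : {set 'I_n}) g (l : seq pos) :
  uniq l -> 5 * (#|B| + g) <= n'.+1 ->
  20 ^ size l * \sum_(x : draw) deficit g #|reached B l x| <=
  9 ^ size l * (#|{: draw}| * deficit g 0).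
Proof.
move=> + hB; elim: l => [_|a l IH /= /andP[al /IH {}IH]].
  rewrite !expn0 !mul1n -sum_nat_const; apply: leq_sum => x _.
  rewrite (_ : reached _ _ _ = set0) ?cards0 //.
  by apply/setP => v; rewrite !inE andbF.
have h : 20 * (n'.+1 * \sum_(x : draw) deficit g #|reached B (a :: l) x|) <=
    9 * n'.+1 * \sum_(x : draw) deficit g #|reached B l x|.
  rewrite -(sum_redraw a) !big_distrr /=.
  by apply: leq_sum => x _; apply: deficit_step.
have {}h : 20 * \sum_(x : draw) deficit g #|reached B (a :: l) x| <=
    9 * \sum_(x : draw) deficit g #|reached B l x| by nia.
rewrite !expnS -mulnA [20 * _]mulnC -mulnA.
rewrite [X in _ * X]mulnC.
apply: (@leq_trans (20 ^ size l * (9 * \sum_(x : draw) deficit g #|reached B l x|))).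
  by rewrite leq_mul2l h orbT.
by rewrite mulnCA -mulnA leq_mul2l IH.
Qed.

(** Markov's inequality with initial potential [4 ^ (2 * h)]. Five messages per unit of [h] suffice
    because [(9/20)^5 * 4^2 < 1/2]. *)
Lemma spread_count (B : {set 'I_n}) h (l : seq pos) :
  uniq l -> size l = 5 * h ->
  5 * (#|B| + h.*2) <= n'.+1 ->
  2 ^ h * #|[set x : draw | #|reached B l x| < h.*2]| <= #|{: draw}|.
Proof.
move=> ul sl hB.
(* [deficit 0 0] is 0 and not a power of 4, so [h = 0] is treated apart. *)
case: (posnP h) => [->|h0].
  by rewrite mul1n; apply: max_card.
have := deficit_sum ul hB; rewrite sl.
have le : #|[set x : draw | #|reached B l x| < h.*2]| <=
    \sum_(x : draw) deficit h.*2 #|reached B l x|.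
  rewrite -sum1_card big_mkcond /=; apply: leq_sum => x _; rewrite inE /deficit.
  by case: ifP => // _; rewrite expn_gt0.
have -> : deficit h.*2 0 = (4 ^ 2) ^ h.
  by rewrite /deficit double_gt0 h0 subn0 -mul2n expnM.
move=> H; refine (@ratio_exp_leq (20 ^ 5) (9 ^ 5) (4 ^ 2) h _ _ _ _ _).
- lia.
- lia.
- rewrite -[(20 ^ 5) ^ h]expnM -[(9 ^ 5) ^ h]expnM.
  exact: leq_trans (leq_mul (leqnn _) le) H.
Qed.

Lemma port_surj u v : v != u -> exists p, port u p = v.
Proof.
move=> vu; have [inj neq] := vport u.
suff : v \in [set port u p | p : D] by case/imsetP => p _ ->; exists p.
have -> : [set port u p | p : D] = [set~ u].
  apply/eqP; rewrite eqEcard; apply/andP; split.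
    by apply/subsetP => w /imsetP[p _ ->]; rewrite !inE neq.
  by rewrite card_imset // cardsC1 !card_ord.
by rewrite !inE.
Qed.

(** A sender other than [v] has exactly one port leading to [v], so each redrawn message misses [v]
    for [n'] of its [n'.+1] values. *)
Lemma miss_count (v : 'I_n) (l : seq pos) :
  uniq l -> {in l, forall a, a.1 != v} ->
  n'.+1 ^ size l * #|[set x : draw | v \notin [seq target x a | a <- l]]| <=
  n' ^ size l * #|{: draw}|.
Proof.
elim: l => [_ _|a l IH /= /andP[al ul] hl].
  by rewrite !mul1n max_card.
have {}IH := IH ul (fun b bl => hl b (mem_behead (s := a :: l) bl)).
have h : n'.+1 * #|[set x : draw | v \notin [seq target x a | a <- a :: l]]| <=
    n' * #|[set x : draw | v \notin [seq target x a | a <- l]]|.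
  rewrite !card_set_sum -(sum_redraw a) big_distrr /=.
  apply: leq_sum => x _.
  have E p : (v \notin [seq target (redraw a x p) b | b <- l]) =
             (v \notin [seq target x b | b <- l]).
    congr (~~ (_ \in _)); apply/eq_in_map => b bl; apply: target_redraw_other.
    by apply: contraNneq al => <-.
  have [p0 hp0] : exists p, port a.1 p = v.
    by apply: port_surj; rewrite eq_sym hl ?mem_head.
  rewrite (bigD1 p0) //= in_cons target_redraw_same hp0 eqxx /= add0n.
  apply: (@leq_trans (\sum_(p < n'.+1 | p != p0)
                        (v \notin [seq target x b | b <- l]))).
    by apply: leq_sum => p _; rewrite in_cons negb_or E; case: (_ == _).
  by rewrite sum_nat_const (cardC1 p0) card_ord.
rewrite !expnS -!mulnA.
apply: (@leq_trans (n'.+1 ^ size l *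
   (n' * #|[set x : draw | v \notin [seq target x a | a <- l]]|))).
  by rewrite mulnCA leq_mul2l h orbT.
by rewrite mulnCA leq_mul2l IH orbT.
Qed.


(** Every node draws [K] ports in every round and uses the first [f] draws; thus one coin type
    serves rounds of different fanout. *)
Definition senders (S : {set 'I_n}) (f : nat) : {set pos} :=
  [set a : pos | (a.1 \in S) && (a.2 < f)].

Lemma card_senders S f : f <= K -> #|senders S f| = #|S| * f.
Proof.
move=> fK; have -> : senders S f = setX S [set j : 'I_K | j < f].
  by apply/setP => -[u j]; rewrite !inE.
rewrite cardsX; congr (_ * _).
have -> : [set j : 'I_K | j < f] = widen_ord fK @: 'I_f.
  apply/setP => j; rewrite inE; apply/idP/imsetP => [jf|[i _ ->]] /=.
    by exists (Ordinal jf) => //; apply: val_inj.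
  exact: ltn_ord.
rewrite card_imset ?card_ord // => i j /(congr1 val) /= ij; exact: val_inj.
Qed.

Lemma take_enum (P : {set pos}) k : k <= #|P| ->
  [/\ uniq (take k (enum P)), {subset take k (enum P) <= P}
    & size (take k (enum P)) = k].
Proof.
move=> kP; split; first by rewrite take_uniq ?enum_uniq.
  by move=> a /mem_take; rewrite mem_enum.
by rewrite size_takel // -cardE.
Qed.

Definition hits S f (x : draw) : {set 'I_n} := target x @: senders S f.

(** Surplus messages only add receivers, so [5 * h] of the positions are kept. *)
Lemma hits_spread (B S : {set 'I_n}) f h : f <= K -> 5 * h <= #|S| * f ->
  5 * (#|B| + h.*2) <= n'.+1 ->
  2 ^ h * #|[set x : draw | #|hits S f x :\: B| < h.*2]| <= #|{: draw}|.
Proof.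
move=> fK hS hB; rewrite -card_senders // in hS.
have [ul sl zl] := take_enum hS.
apply: leq_trans (spread_count ul zl hB); rewrite leq_mul2l.
apply/orP; right; apply/subset_leq_card/subsetP => x; rewrite !inE.
apply: leq_ltn_trans; apply/subset_leq_card/subsetP => v; rewrite !inE.
case/andP=> -> /hasP[a al /eqP <-] /=; apply: imset_f; exact: sl.
Qed.

(** Two terms of the binomial expansion. For [a = k = n'] it shows that [n'.+1] messages miss a
    given node with probability at most 1/2. *)
Lemma leq_bernoulli a k : a ^ k.+1 + k.+1 * a ^ k <= a.+1 ^ k.+1.
Proof.
elim: k => [|k IH]; first by rewrite !expn1 expn0; lia.
by rewrite [a.+1 ^ _]expnS; move: IH; rewrite !expnS; nia.
Qed.

(** The messages contain [q] batches of size [n'.+1], each missing [v] with probability at most 1/2.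
    The predecessor of [#|S|] accounts for [v] itself, which has no port to itself. *)
Lemma hits_cover (S : {set 'I_n}) f q v : 0 < n' -> f <= K ->
  n'.+1 * q <= #|S|.-1 * f ->
  2 ^ q * #|[set x : draw | v \notin hits S f x]| <= #|{: draw}|.
Proof.
move=> n0 fK hS.
have {}hS : n'.+1 * q <= #|senders (S :\ v) f|.
  rewrite card_senders //; apply: leq_trans hS _; rewrite leq_mul2r.
  apply/orP; right; rewrite [in X in X <= _](cardsD1 v).
  by case: (v \in S); rewrite //= ?add0n ?leq_pred.
have [ul sl zl] := take_enum hS.
have hl : {in take (n'.+1 * q) (enum (senders (S :\ v) f)),
            forall a : pos, a.1 != v}.
  by move=> a /sl; rewrite !inE => /andP[/andP[]].
have := miss_count ul hl; rewrite zl => H.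
have p0 : 0 < n' ^ (n'.+1 * q) by rewrite expn_gt0 n0.
rewrite -(leq_pmul2l p0); apply: leq_trans H.
rewrite mulnA; apply: leq_mul.
  rewrite mulnC !expnM -expnMn; case: (posnP q) => [-> //|q0].
  rewrite leq_exp2r //; have := leq_bernoulli n' n'.
  by rewrite mul2n -addnn; apply: leq_trans; rewrite leq_add2l expnS leq_mul2r leqnSn orbT.
apply/subset_leq_card/subsetP => x; rewrite !inE.
apply: contra => /mapP[a al ->]; apply: imset_f.
by move/sl: al; rewrite !inE => /andP[/andP[_ ->] ->].
Qed.

End Targets.

(** * The gossip algorithm: invariants and message count *)

Section Gossip.
Variables (n' m lg : nat).
Local Notation n := n'.+2.

(** As 60/25 exceeds 2, a burst from [n %/ 25] nodes contains [2 * lg] batches of [n'.+1] messages;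
    see [uncovered_count]. *)
Definition burst := 60 * lg.

Definition fanout r := if 0 < r <= lg then 5 else burst.

Definition least (s : seq 'I_m) : option 'I_m :=
  [pick y | (y \in s) && all (fun z : 'I_m => y <= z) s].

Lemma least_mem s y : least s = Some y -> y \in s.
Proof. by rewrite /least; case: pickP => // z /andP[zs _] [<-]. Qed.

Lemma leastE (s : seq 'I_m) (y : 'I_m) :
  y \in s -> {in s, forall z : 'I_m, y <= z} -> least s = Some y.
Proof.
move=> ys ymin; rewrite /least; case: pickP => [z /andP[zs /allP zmin]|].
  by congr Some; apply/val_inj/anti_leq; rewrite zmin ?ymin.
by move/(_ y)/negP; case; rewrite ys; apply/allP.
Qed.

(* Apart from the initial input, the current value is the least value received
   in the present round: a node keeps no memory of earlier values. *)
Definition heard (st : nat * option 'I_m) (ib : 'I_n.-1 -> seq 'I_m) :=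
  if st.1 == 0 then st.2 else least (flatten [seq ib q | q <- enum 'I_n.-1]).

(** As a set: a port drawn several times carries one message. *)
Definition chosen (x : {ffun 'I_burst -> 'I_n.-1}) r : {set 'I_n.-1} :=
  x @: [set j : 'I_burst | j < fanout r].

(** Round 0 is the opening burst, rounds 1 to [lg] double, round [lg.+1] is the covering burst and
    round [lg.+2] reads it. The state carries the round number because [step] does not receive
    it. *)
Definition gossip : algo n m :=
  @Algo n m (nat * option 'I_m)%type 'I_m {ffun 'I_burst -> 'I_n'.+1}
    [ffun=> ord0] lg.+3 (fun x => (0, Some x))
    (fun st ib x =>
       ((st.1.+1, heard st ib),
        fun p => if p \in chosen x st.1 then seq_of_opt (heard st ib) else [::]))
    snd.

Variables (port : ports n) (inp : 'I_n -> 'I_m) (adv : adversary gossip).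
Hypothesis vport : valid_ports port.

Local Notation coins := (coin_space gossip).
Local Notation hist := (configs port inp adv).

Definition cfg (w : coins) t := last (init_config inp) (hist w t).
Definition blocked (w : coins) t := adv t (take (maxn 1 t) (hist w t)).
(** The value held in round [t] after reading the inbox; it depends only on the coins of earlier
    rounds. *)
Definition current (w : coins) t v :=
  heard (cst (cfg w t) v) (inbox port (cfg w t) (blocked w t) v).

Lemma cfgS w t : cfg w t.+1 = round port (cfg w t) (blocked w t) (coin_at w t).
Proof. by rewrite /cfg /= last_rcons. Qed.

Lemma size_hist w t : size (hist w t) = t.+1.
Proof. by elim: t => //= t IH; rewrite size_rcons IH. Qed.

(** Lateness in usable form: [hist w t] involves no coin of round [t]. *)
Lemma blockedS w t : blocked w t.+1 = adv t.+1 (hist w t).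
Proof.
rewrite /blocked (_ : maxn 1 t.+1 = t.+1); last by lia.
by rewrite /= -cats1 take_size_cat ?size_hist.
Qed.

Lemma cst_round w t v : (cst (cfg w t) v).1 = t.
Proof. by elim: t => [|t IH] //; rewrite cfgS /= IH. Qed.

Lemma current0 w v : current w 0 v = Some (inp v).
Proof. by []. Qed.

Lemma mem_cout w t v p y : (y \in cout (cfg w t.+1) v p) =
  [&& v \notin blocked w t, p \in chosen (coin_at w t v) t
    & current w t v == Some y].
Proof.
rewrite cfgS /= cst_round -/(current w t v); case: (v \in _) => //=.
case: (p \in _) => //=; case: (current w t v) => [z|] //=.
by rewrite inE eq_sym.
Qed.

Lemma mem_inbox w t v (c := cfg w t) y :
  reflect (exists u p, [/\ v \notin blocked w t, port u p = v
                         & y \in cout c u p])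
    (y \in flatten [seq inbox port c (blocked w t) v q | q <- enum 'I_n.-1]).
Proof.
apply: (iffP flatten_mapP) => [[q _]|[u [p [vB pv yc]]]].
  rewrite /inbox; case: ifP => // vB; case: pickP => // p /eqP pv yc.
  by exists (port v q), p.
have [q qu] : exists q, port v q = u.
  by apply: port_surj => //; rewrite -pv; have [_ /(_ p)] := vport u; rewrite eq_sym.
exists q; first by rewrite mem_enum.
rewrite /inbox (negbTE vB) qu; case: pickP => [p' /eqP p'v|/(_ p)]; last by rewrite pv eqxx.
by have -> : p' = p by apply: (proj1 (vport u)); rewrite p'v.
Qed.

Lemma currentS w t v : current w t.+1 v =
  least (flatten [seq inbox port (cfg w t.+1) (blocked w t.+1) v q
                 | q <- enum 'I_n.-1]).
Proof. by rewrite /current /heard cst_round. Qed.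

(** Every message descends from an input of a node unblocked in round 0, since later values are all
    received ones. Validity takes [pred1 x] for [P], minimality takes [best <= _]. *)
Lemma cout_inv (P : pred 'I_m) w t u p y :
  (forall v, v \notin blocked w 0 -> P (inp v)) ->
  y \in cout (cfg w t) u p -> P y.
Proof.
move=> hP; elim: t u p y => [|t IH] u p y //.
rewrite mem_cout => /and3P[ub _ /eqP]; case: t IH ub => [_ ub|t IH ub].
  by rewrite current0 => -[<-]; apply: hP.
rewrite currentS => /least_mem /mem_inbox[u' [p' [_ _]]]; exact: IH.
Qed.

Lemma current_inv (P : pred 'I_m) w t v y :
  (forall v, v \notin blocked w 0 -> P (inp v)) ->
  current w t.+1 v = Some y -> P y.
Proof.
move=> hP; rewrite currentS => /least_mem /mem_inbox[u [p [_ _]]].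
exact: cout_inv.
Qed.

Lemma decisionE w v : decision port inp adv w v = current w lg.+2 v.
Proof.
rewrite /decision /final.
by rewrite -/(cfg w _) cfgS.
Qed.

Lemma msgs_in_cfgS w t : msgs_in (cfg w t.+1) <= n * fanout t.
Proof.
rewrite /msgs_in -[n in n * _]card_ord -sum_nat_const; apply: leq_sum => v _.
rewrite cfgS /= cst_round; case: (v \in _).
  by rewrite big1.
apply: (@leq_trans (\sum_(p < n'.+1) (p \in chosen (coin_at w t v) t))).
  apply: leq_sum => p _; case: (p \in _) => //=; by case: heard.
rewrite -big_mkcond /= sum1_card; apply: leq_trans (leq_imset_card _ _) _.
rewrite cardE -(size_map val) -[fanout t](size_iota 0).
apply: uniq_leq_size; first by rewrite (map_inj_uniq val_inj) enum_uniq.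
by move=> i /mapP[j]; rewrite mem_enum inE => jf ->; rewrite mem_iota -(size_iota 0 (fanout t)).
Qed.

(** Rounds 0, [lg.+1] and [lg.+2] are bursts and [lg] rounds push five messages:
    [185 = 3 * 60 + 5]. *)
Lemma total_msgs_leq w : total_msgs port inp adv w <= n * (185 * lg).
Proof.
have H t : \sum_(c <- hist w t) msgs_in c <= n * \sum_(r < t) fanout r.
  elim: t => [|t IH]; first by rewrite /= big_seq1 big_ord0 /msgs_in !big1 // => v _; rewrite big1.
  rewrite /= -cats1 big_cat big_seq1 big_ord_recr mulnDr leq_add //=.
  by have := msgs_in_cfgS w t; rewrite cfgS.
apply: leq_trans (H _) _; rewrite leq_mul2l; apply/orP; right.
rewrite [rounds _]/= big_ord_recl !big_ord_recr /=.
rewrite (eq_bigr (fun=> 5)) => [|i _]; last by rewrite /fanout /= /bump /= add1n ltn_ord.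
rewrite sum_nat_const card_ord /fanout /= /bump /= !add1n ltnn.
rewrite [_ < lg](_ : _ = false); last by lia.
by rewrite /burst; lia.
Qed.

(** * Redrawing the coins of one round *)

Local Notation draw := {ffun 'I_n -> {ffun 'I_burst -> 'I_n'.+1}}.

Definition set_round (i : 'I_lg.+3) (w : coins) (x : draw) : coins :=
  [ffun k => if k == i then x else w k].

Lemma sum_set_round i (f : coins -> nat) :
  \sum_w \sum_(x : draw) f (set_round i w x) = #|{: draw}| * \sum_w f w.
Proof.
rewrite (sum_resample (get := fun w : coins => w i)) //.
- by move=> w x; rewrite !ffunE eqxx.
- by move=> w; apply/ffunP => k; rewrite !ffunE; case: eqP => // ->.
- by move=> w x x'; apply/ffunP => k; rewrite !ffunE; case: eqP.
Qed.

Lemma hist_set_round (i : 'I_lg.+3) w x t : t <= i -> hist (set_round i w x) t = hist w t.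
Proof.
elim: t => [|t IH] // ti; rewrite /= IH ?(ltnW ti) //; congr (rcons _ (round _ _ _ _)).
rewrite /coin_at; case: insubP => // k _ kt.
have -> // : set_round i w x k = w k.
by rewrite ffunE; case: eqP => // ki; move: ti; rewrite -ki kt ltnn.
Qed.

Lemma coin_at_ord (w : coins) (i : 'I_lg.+3) v : coin_at w i v = w i v.
Proof. by rewrite /coin_at valK. Qed.

(** * Nodes informed of the least input that is unblocked in round 0 *)

Variable best : 'I_m.
Hypothesis best_min : forall v, v \notin adv 0 [:: init_config inp] -> best <= inp v.
Hypothesis best_inp : exists2 v, v \notin adv 0 [:: init_config inp] & inp v = best.

(** Being unblocked in round [t] ensures that the messages of that round leave the node. *)
Definition informed w t : {set 'I_n} :=
  [set v | (v \notin blocked w t) && (current w t v == Some best)].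

Lemma informed_set_round (i : 'I_lg.+3) w x :
  informed (set_round i w x) i = informed w i.
Proof.
by rewrite /informed /current /blocked /cfg hist_set_round.
Qed.

Lemma blocked_set_round (i : 'I_lg.+3) w x :
  blocked (set_round i w x) i.+1 = blocked w i.+1.
Proof. by rewrite !blockedS hist_set_round. Qed.

(** An unblocked target receives [best], and by [cout_inv] no smaller value circulates, so [best] is
    its least received value. *)
Lemma hits_informed w (i : 'I_lg.+3) :
  hits port (informed w i) (fanout i) (w i) :\: blocked w i.+1
    \subset informed w i.+1.
Proof.
apply/subsetP => v; rewrite 2!inE => /andP[vB /imsetP[[u j]]].
rewrite /target /= !inE /= => /andP[/andP[uB /eqP ub] jf] vE.
rewrite vB; apply/eqP; rewrite currentS; apply: leastE.
  apply/mem_inbox; exists u, (w i u j); split=> //.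
  rewrite mem_cout uB ub eqxx andbT /= coin_at_ord.
  by apply: imset_f; rewrite inE.
move=> z /mem_inbox[u' [p' [_ _]]].
exact: (cout_inv (P := fun z : 'I_m => best <= z)).
Qed.

(* The blocked set of round [i.+1] and the informed set of round [i] do not
   depend on the coins of round [i]: this is where the lateness is used. *)
Lemma card_event (i : 'I_lg.+3) (Q : {set 'I_n} -> {set 'I_n} -> pred draw) c :
  (forall w, c * #|[set x | Q (informed w i) (blocked w i.+1) x]|
             <= #|{: draw}|) ->
  c * #|[set w : coins | Q (informed w i) (blocked w i.+1) (w i)]|
    <= #|{: coins}|.
Proof.
move=> hQ; have d0 : 0 < #|{: draw}|.
  by apply/card_gt0P; exists [ffun=> [ffun=> ord0]].
rewrite -(leq_pmul2l d0) card_set_sum mulnCA -(sum_set_round i) big_distrr /=.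
rewrite mulnC -sum_nat_const; apply: leq_sum => w _.
apply: leq_trans (hQ w); rewrite leq_mul2l card_set_sum; apply/orP; right.
apply: leq_sum => x _.
by rewrite informed_set_round blocked_set_round ffunE eqxx.
Qed.

(** * Failure probability of each round *)

Hypothesis n_ge : 1024 <= n.
Hypothesis n_leq_exp : n <= 2 ^ lg.
Hypothesis lg_gt0 : 0 < lg.
Hypothesis lg_leq : lg <= n %/ 25.
Hypothesis adv_leq : forall r h, 10 * #|adv r h| <= n.

(* Number of informed nodes aimed at in round [t]; starting from the [lg] nodes
   reached in the initial burst it doubles until it is a fixed fraction of [n]. *)
Definition goal t := if t is t'.+1 then minn (lg * 2 ^ t') (n %/ 25) else 1.

Lemma goal_geq t : lg <= goal t.+1.
Proof.
by rewrite leq_min lg_leq andbT leq_pmulr // expn_gt0.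
Qed.

(** The premise that the previous goal was met belongs to the event, so each round is bounded
    without conditioning on earlier ones. *)
Definition stalled t (S B : {set 'I_n}) (x : draw) :=
  (goal t <= #|S|) && (#|hits port S (fanout t) x :\: B| < goal t.+1).

Definition uncovered (S : {set 'I_n}) (x : draw) :=
  (n %/ 25 <= #|S|) && [exists v, v \notin hits port S burst x].

Lemma fanout_leq t : fanout t <= burst.
Proof. by rewrite /fanout; case: ifP => // _; rewrite /burst; lia. Qed.

(** [hits_spread] applies since [n/10] blocked and [2n/25] new nodes make up less than a fifth of
    all; [h >= lg] gives [2 ^ h >= n]. *)
Lemma stalled_count t (S B : {set 'I_n}) : t <= lg -> 10 * #|B| <= n ->
  n * #|[set x | stalled t S B x]| <= #|{: draw}|.
Proof.
move=> tl hB; rewrite /stalled; case: (leqP (goal t) #|S|) => hS; last first.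
  by rewrite (_ : [set x | _] = set0) ?cards0 ?muln0 //; apply/setP => x; rewrite !inE.
(* In round 0 a single informed node sends a whole burst; later, [goal t] nodes send five messages
   each. *)
pose h := if t is 0 then lg else goal t.
have h_lg : lg <= h by rewrite /h; case: (t) => // t'; apply: goal_geq.
have h_n : h <= n %/ 25 by rewrite /h; case: (t) => //= t'; apply: geq_minr.
have h5 : 5 * h <= #|S| * fanout t.
  rewrite /h; case: t tl hS {h h_lg h_n} => [|t] tl hS.
    by rewrite /fanout /burst /=; move: hS => /=; nia.
  by rewrite /fanout /= tl mulnC leq_mul2r hS orbT.
have hg : goal t.+1 <= h.*2.
  rewrite /h; case: (t) => [|t'].
    by rewrite /goal expn0 muln1; apply: leq_trans (geq_minl _ _) _; lia.
  by rewrite /goal expnS; move: (2 ^ t') => e; lia.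
have hB5 : 5 * (#|B| + h.*2) <= n'.+1 by move: n_ge; lia.
apply: leq_trans (hits_spread vport (fanout_leq t) h5 hB5).
apply: leq_mul; first by apply: leq_trans n_leq_exp _; rewrite leq_exp2l.
apply/subset_leq_card/subsetP => x; rewrite !inE /= => hx.
exact: leq_trans hx hg.
Qed.

(** A given node is missed with probability at most [2 ^ -(2 * lg) <= n ^ -2]; the union bound over
    the nodes costs a factor [n]. *)
Lemma uncovered_count (S : {set 'I_n}) :
  n * #|[set x | uncovered S x]| <= #|{: draw}|.
Proof.
rewrite /uncovered; case: (leqP (n %/ 25) #|S|) => hS; last first.
  by rewrite (_ : [set x | _] = set0) ?cards0 ?muln0 //; apply/setP => x; rewrite !inE.
have n'0 : 0 < n' by move: n_ge; lia.
have hq : n'.+1 * (2 * lg) <= #|S|.-1 * burst.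
  rewrite /burst; have : n'.+1 * 2 <= #|S|.-1 * 60 by move: n_ge; lia.
  by move=> ?; nia.
have H v : n * (n * #|[set x : draw | v \notin hits port S burst x]|) <= #|{: draw}|.
  apply: leq_trans (hits_cover vport v n'0 (leqnn _) hq).
  by rewrite mulnA leq_mul2r mul2n -addnn expnD leq_mul ?orbT.
rewrite -(@leq_pmul2l n) //.
have -> : n * #|{: draw}| = \sum_(v < n) #|{: draw}| by rewrite sum_nat_const card_ord.
apply: (@leq_trans (\sum_(v < n)
          n * (n * #|[set x : draw | v \notin hits port S burst x]|))).
  rewrite -!big_distrr /= !leq_mul2l /=.
  exact: card_exists_leq.
by apply: leq_sum => v _.
Qed.

Definition agree w := #|[set v | decision port inp adv w v == Some best]|.

Definition failed (w : coins) (i : 'I_lg.+3) :=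
  if i <= lg then stalled i (informed w i) (blocked w i.+1) (w i)
  else uncovered (informed w i) (w i).

Lemma failed_count i : n * #|[set w | failed w i]| <= #|{: coins}|.
Proof.
rewrite /failed; case: (leqP i lg) => hi.
  apply: (card_event (Q := stalled i)) => w; apply: stalled_count => //.
  exact: adv_leq.
apply: (card_event (Q := fun S _ => uncovered S)) => w; exact: uncovered_count.
Qed.

(** Without failure all goals are met in turn, and the burst of round [lg.+1] hits every node; those
    unblocked in round [lg.+2] decide [best]. *)
Lemma agree_geq w : ~~ [exists i, failed w i] ->
  n <= agree w + #|blocked w lg.+2|.
Proof.
rewrite negb_exists => /forallP ok.
have grow t : t <= lg.+1 -> goal t <= #|informed w t|.
  elim: t => [_|t IH tl].
    have [v vB vE] := best_inp; apply/card_gt0P; exists v.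
    by rewrite inE vB current0 vE /=.
  have {}IH := IH (ltnW tl).
  have ti : t < lg.+3 by apply: leq_trans tl _; rewrite ltnW.
  have := ok (Ordinal ti); rewrite /failed /= -ltnS tl /stalled IH /= -leqNgt.
  move/leq_trans; apply; apply: subset_leq_card.
  exact: (hits_informed w (Ordinal ti)).
have il : lg.+1 < lg.+3 by [].
have /= := ok (Ordinal il); rewrite /failed /= ltnn /uncovered.
(* The cap of [goal] is attained by then, because [lg * 2 ^ lg >= n]. *)
have -> : n %/ 25 <= #|informed w lg.+1|.
  apply: leq_trans (grow _ (leqnn _)); rewrite leq_min leqnn andbT.
  apply: leq_trans (leq_div _ _) _; apply: leq_trans n_leq_exp _.
  exact: leq_pmull.
rewrite /= negb_exists => /forallP cov.
have := cardC (mem (blocked w lg.+2)); rewrite card_ord => cB.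
rewrite -[X in X <= _]cB addnC leq_add2r.
apply/subset_leq_card/subsetP => v; rewrite !inE decisionE => vB.
have /subsetP/(_ v) := hits_informed w (Ordinal il).
rewrite !inE /= vB /=; apply; move: (cov v); rewrite negbK.
by rewrite /fanout /= ltnn.
Qed.

Lemma card_disagree_leq :
  n * #|[set w | ~~ (n <= agree w + #|blocked w lg.+2|)]| <=
  lg.+3 * #|{: coins}|.
Proof.
apply: (@leq_trans (n * #|[set w | [exists i, failed w i]]|)).
  rewrite leq_mul2l; apply/orP; right; apply/subset_leq_card/subsetP => w.
  by rewrite !inE; apply: contraR => /agree_geq.
apply: (@leq_trans (n * \sum_i #|[set w | failed w i]|)).
  by rewrite leq_mul2l card_exists_leq orbT.
have -> : lg.+3 * #|{: coins}| = \sum_(i < lg.+3) #|{: coins}|.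
  by rewrite sum_nat_const card_ord.
rewrite big_distrr /=.
apply: leq_sum => i _; exact: failed_count.
Qed.

End Gossip.

(** * Choice of parameters and real estimates *)

Definition idle_algo n m : algo n m :=
  @Algo n m unit unit unit tt 0 (fun=> tt) (fun _ _ _ => (tt, fun=> [::]))
    (fun=> None).

(** The successor of the truncated logarithm makes [n < 2 ^ lg]. [gossip] presupposes two nodes,
    hence the placeholder for smaller [n]. *)
Definition gossip_algo (n m : nat) : algo n m :=
  match n with
  | n'.+2 => gossip n' m (trunc_log 2 n'.+2).+1
  | n => idle_algo n m
  end.

Lemma INR_expn a k : INR (a ^ k) = (INR a ^ k)%real.
Proof. by elim: k => // k IH; rewrite expnS mult_INR IH. Qed.

Lemma leq_INR a b : a <= b -> (INR a <= INR b)%real.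
Proof. by move/leP; apply: le_INR. Qed.

Lemma trunc_log_le_ln n : 0 < n -> (INR (trunc_log 2 n) <= 2 * ln (INR n))%real.
Proof.
move=> n0; have /andP[/leq_INR le _] := trunc_log_bounds (p := 2) isT n0.
set k := trunc_log 2 n in le *; move: le; rewrite INR_expn /= => le.
have p0 : (0 < (1 + 1) ^ k)%real by apply: pow_lt; lra.
have : (ln ((1 + 1) ^ k) <= ln (INR n))%real.
  by case: le => [lt|<-]; [left; apply: ln_increasing | right].
rewrite ln_pow; last by lra.
have := ln_lt_2; have := pos_INR k; rewrite (_ : (1 + 1)%real = 2%real) //; nra.
Qed.

(** With [lg = k.+1], the first bound gives [lg <= n %/ 25], the second brings the total failure
    ratio [lg.+3 / n] below [n ^ (-1/2)]. *)
Lemma exp2_geq k : 10 <= k -> 25 * k.+1 <= 2 ^ k /\ k.+4 * k.+4 <= 2 ^ k.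
Proof.
move/subnK => <-; elim: (k - 10) => [|j [IH1 IH2]]; first by split.
by rewrite addSn expnS; split; nia.
Qed.

Lemma ratio_le_Rpower_half (q n : nat) : 0 < n -> q * q <= n ->
  (INR q / INR n <= Rpower (INR n) (- / 2))%real.
Proof.
move=> n0 /leq_INR; rewrite mult_INR => qn.
have pn : (0 < INR n)%real by apply: lt_0_INR; apply/ltP.
have ps := sqrt_lt_R0 _ pn; have ss := sqrt_sqrt _ (Rlt_le _ _ pn).
rewrite Rpower_Ropp Rpower_sqrt //.
have qs : (INR q <= sqrt (INR n))%real.
  by rewrite -(sqrt_square (INR q) (pos_INR q)); apply: sqrt_le_1_alt.
apply: (Rmult_le_reg_r (INR n)) => //.
rewrite -{4}ss /Rdiv Rmult_assoc Rinv_l; last by lra.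
by rewrite -Rmult_assoc Rinv_l; lra.
Qed.

Lemma prob_geq (T : finType) (P : pred T) (n q : nat) : 0 < n ->
  0 < #|T| -> n * #|[set w | ~~ P w]| <= q * #|T| ->
  (1 - INR q / INR n <= prob T P)%real.
Proof.
move=> n0 T0 /leq_INR; rewrite !mult_INR => H; rewrite /prob.
have pn : (0 < INR n)%real by apply: lt_0_INR; apply/ltP.
have pT : (0 < INR #|{: T}|)%real by apply: lt_0_INR; apply/ltP.
have -> : #|[set w | P w]| = #|T| - #|[set w | ~~ P w]|.
  rewrite -(cardsC [set w | P w]) (_ : ~: _ = [set w | ~~ P w]) ?addnK //.
  by apply/setP => w; rewrite !inE.
rewrite minus_INR; last by apply/leP; apply: max_card.
apply: (Rmult_le_reg_r (INR n * INR #|{: T}|)); first by nra.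
move: H; set b := INR #|[set w | ~~ P w]|; set N := INR #|T| => H.
have -> : ((1 - INR q / INR n) * (INR n * N) = INR n * N - INR q * N)%real.
  by field; lra.
have -> : ((N - b) / N * (INR n * N) = INR n * N - INR n * b)%real.
  by field; rewrite /N; lra.
by lra.
Qed.

Theorem theorem3 :
  forall eps delta : R,
  Rle 0 eps -> Rle eps (Rdiv 1 10) -> Rlt 0 delta -> Rlt delta 1 ->
  forall c : nat,  (* input domain size at most n ^ c *)
  exists (A : forall n m : nat, algo n m) (C a : R) (n0 : nat),
    Rlt 0 a /\
    forall n m : nat, (n0 <= n)%N -> (m <= n ^ c)%N ->
      Rle (INR (rounds (A n m))) (Rmult C (ln (INR n))) /\
      forall (port : ports n) (inp : 'I_n -> 'I_m) (adv : adversary (A n m)),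
        valid_ports port -> eps_bounded eps adv ->
        (forall w, Rle (INR (total_msgs port inp adv w))
                       (Rmult (Rmult C (INR n)) (ln (INR n)))) /\
        (forall x : 'I_m, (forall v, inp v = x) ->
           forall w v y, decision port inp adv w v = Some y -> y = x) /\
        Rle (Rminus 1 (Rpower (INR n) (Ropp a)))
            (prob (coin_space (A n m)) (fun w => Rleb (Rmult (Rminus 1 (Rdiv eps delta)) (INR n))
                                 (INR (max_agree port inp adv w)))).
Proof.
move=> eps delta eps0 eps1 delta0 delta1 c.
(* [740 = 185 * 2 * 2], from [lg = k + 1 <= 2 * k] and [k <= 2 * ln n]; [1024 = 2 ^ 10] gives
   [k >= 10]. *)
exists gossip_algo, 740%real, (/ 2)%real, 1024; split; first by lra.
case=> [|[|n']] // m n_ge _; rewrite [gossip_algo _ _]/=.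
set k := trunc_log 2 n'.+2.
have /andP[k_lo k_hi] := trunc_log_bounds (p := 2) (n := n'.+2) isT isT.
rewrite -/k in k_lo k_hi.
have k10 : 10 <= k by apply: (trunc_log_max (p := 2)).
have [k_25 k_sq] := exp2_geq k10.
have kln : (INR k <= 2 * ln (INR n'.+2))%real by apply: trunc_log_le_ln.
have lg_le q : q <= 370 * k -> (INR q <= 740 * ln (INR n'.+2))%real.
  by move/leq_INR; rewrite mult_INR [INR 370]/=; lra.
split; first by apply: lg_le; rewrite /=; lia.
move=> port inp adv vport eps_bd; split; [|split].
- move=> w; have /leq_INR := total_msgs_leq port inp adv w.
  rewrite mult_INR => H; apply: Rle_trans H _.
  have := lg_le (185 * k.+1) ltac:(lia); have := pos_INR n'.+2; nra.
- move=> x inpx w v y; rewrite decisionE => dv.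
  by apply/eqP; apply: (current_inv vport (P := pred1 x)) dv => u _; rewrite /= inpx.
have adv_leq r h : 10 * #|adv r h| <= n'.+2.
  apply/leP/INR_le; rewrite mult_INR; have := eps_bd r h.
  by have := pos_INR n'.+2; rewrite [INR 10]/=; nra.
set B0 := adv 0 [:: init_config inp].
have [v0 v0B] : exists v, v \notin B0.
  have : 0 < #|~: B0|.
    have := cardsC B0; have := adv_leq 0 [:: init_config inp].
    by rewrite card_ord -/B0; lia.
  by case/card_gt0P => v; rewrite inE; exists v.
(* [B0] depends only on the initial configuration, so [best] is fixed before any coin is drawn. *)
have [best best_min best_inp] : exists2 best : 'I_m,
    forall v, v \notin B0 -> best <= inp v & exists2 v, v \notin B0 & inp v = best.
  case: (@arg_minnP _ v0 (fun v => v \notin B0) inp v0B) => v vB vmin.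
  by exists (inp v) => //; exists v.
have n_pos : (0 < INR n'.+2)%real by apply: lt_0_INR; apply/ltP.
have H := card_disagree_leq vport best_min best_inp n_ge (ltnW k_hi) isT.
have {}H := H ltac:(lia) adv_leq.
apply: Rle_trans (prob_geq (n := n'.+2) (q := k.+4) _ _ _) => //.
- have := @ratio_le_Rpower_half k.+4 n'.+2 isT (leq_trans k_sq k_lo); lra.
- by apply/card_gt0P; exists [ffun=> [ffun=> [ffun=> ord0]]].
apply: leq_trans H; rewrite leq_mul2l; apply/orP; right.
apply/subset_leq_card/subsetP => w; rewrite !inE; apply: contra => agr.
rewrite /Rleb; case: Rle_dec => //; case.
have le_max : agree port inp adv best w <= max_agree port inp adv w.
  exact: (leq_bigmax (F := fun y => #|[set v | decision port inp adv w v == Some y]|)).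
have B_le : (INR #|blocked port inp adv w k.+3| <= eps * INR n'.+2)%real.
  exact: eps_bd.
(* As [delta < 1], agreement among [(1 - eps) * n] nodes is enough. *)
have epsd : (eps <= eps / delta)%real.
  apply: (Rmult_le_reg_r delta) => //; rewrite /Rdiv Rmult_assoc Rinv_l; last by lra.
  by nra.
have := Rmult_le_compat_r _ _ _ (Rlt_le _ _ n_pos) epsd.
have := leq_INR agr; have := leq_INR le_max; rewrite plus_INR; lra.
Qed.
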